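(* Let $G$ be a finite simple graph and let $x\in V(G)$. If $d_G(x)\le \mathrm{gcol}(G-x)$, then $\mathrm{gcol}(G)\le \mathrm{gcol}(G-x)+1$.
   Context: All graphs are finite and simple; $d_G(x)$ is the degree of $x$ in $G$ and $G-x$ is the graph obtained from $G$ by deleting the vertex $x$. For a linear ordering $\tau$ of all vertices of $G=(V,E)$ and $v\in V$, let $N_G^+(\tau,v)$ be the set of neighbors $u$ of $v$ in $G$ with $u<_\tau v$, let $N_G^+[\tau,v]=N_G^+(\tau,v)\cup\{v\}$, and let $\mathrm{col}(G,\tau)=\max_{v\in V}|N_G^+[\tau,v]|$ (taken to be $0$ if $V=\emptyset$). In the ordering game on $G$, Alice and Bob, with Alice moving first, alternately choose a not-yet-chosen vertex of $G$ and append it to the end of the current sequence (initially empty) until all vertices are listed, giving a linear ordering $\tau$ of $V$. The score is $\mathrm{col}(G,\tau)$; Alice tries to minimize it and Bob tries to maximize it. The game coloring number $\mathrm{gcol}(G)$ is the least $s$ such that Alice has a strategy guaranteeing a score of at most $s$ however Bob plays. *)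

(* Defs.v *)
From mathcomp Require Import all_boot.
From mathcomp Require Import boolp.

Set Implicit Arguments.
Unset Strict Implicit.
Unset Printing Implicit Defensive.

Record sgraph := SGraph {
  vertex :> finType;
  adj : rel vertex;
  adj_sym : symmetric adj;
  adj_irr : irreflexive adj
}.

Definition degree (G : sgraph) (x : G) : nat := #|[set u : G | adj x u]|.

Section DeleteVertex.
Variables (G : sgraph) (x : G).

Definition del_adj : rel {y : G | y != x} := fun u v => adj (val u) (val v).

Lemma del_adj_sym : symmetric del_adj.
Proof. by move=> u v; rewrite /del_adj adj_sym. Qed.

Lemma del_adj_irr : irreflexive del_adj.
Proof. by move=> u; rewrite /del_adj adj_irr. Qed.

Definition del_vertex : sgraph := SGraph del_adj_sym del_adj_irr.

End DeleteVertex.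

Section OrderingGame.
Variable G : sgraph.

(* A linear ordering is the list of all vertices, smallest first. *)
Definition linear_ordering (tau : seq G) : bool := perm_eq tau (enum G).

Definition before (tau : seq G) (u v : G) : bool := index u tau < index v tau.

Definition Nplus (tau : seq G) (v : G) : {set G} :=
  [set u | adj v u && before tau u v].

Definition Nplus_closed (tau : seq G) (v : G) : {set G} := v |: Nplus tau v.

Definition col (tau : seq G) : nat := \max_(v : G) #|Nplus_closed tau v|.

(* A strategy for Alice maps the current sequence to her next vertex. It is
   partial because no move exists once every vertex has been listed (in
   particular on the empty graph). Alice moves first, so it is her turn exactly
   when the current sequence has even length; there she must name a vertex not
   chosen yet. *)
Definition alice_strategy (sigma : seq G -> option G) : Prop :=
  forall s : seq G, uniq s -> ~~ odd (size s) -> size s < #|G| ->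
    exists2 v : G, sigma s = Some v & v \notin s.

Definition follows (sigma : seq G -> option G) (tau : seq G) : Prop :=
  forall (s : seq G) (v : G) (t : seq G),
    tau = s ++ v :: t -> ~~ odd (size s) -> sigma s = Some v.

(* Bob's moves are unconstrained, so the complete plays against sigma are the
   linear orderings that follow sigma. *)
Definition guarantees (sigma : seq G -> option G) (k : nat) : Prop :=
  forall tau : seq G, linear_ordering tau -> follows sigma tau -> col tau <= k.

Definition alice_can_guarantee (k : nat) : Prop :=
  exists2 sigma : seq G -> option G, alice_strategy sigma & guarantees sigma k.

Lemma alice_can_guarantee_ex : exists k, `[< alice_can_guarantee k >].
Proof.
exists #|G|; apply/asboolP; exists (fun s => [pick v | v \notin s]).
  move=> s us _ lts; case: pickP => [v nsv|all_s]; first by exists v.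
  have: #|G| <= size s.
    rewrite -(card_uniqP us); apply/subset_leq_card/subsetP => v _.
    by move/negbFE: (all_s v).
  by rewrite leqNgt lts.
by move=> tau _ _; apply/bigmax_leqP => v _; apply: max_card.
Qed.

Definition gcol : nat := ex_minn alice_can_guarantee_ex.

End OrderingGame.

(* Main.v *)
Require Import Defs.
From mathcomp Require Import all_boot.
From mathcomp Require Import boolp zify.

(** A score of at most [k] means that every vertex, at the moment it is listed,
has fewer than [k] neighbours already listed ([col_leP]).  So all that matters
of a position is the set [S] of listed vertices and whose turn it is, and Alice
can guarantee [k] exactly when she wins from [set0] the game in which each move
has to respect this bound ([alice_can_guarantee_wins],
[wins_alice_can_guarantee]).

Call a vertex of degree less than [k] light: listing it is safe at any time.
The key fact ([wins_unlist]) is that a position won by Alice is still won after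
a light vertex [y] is taken off the list, with the same player to move.  Alice
plays as if [y] were listed, which only overestimates the back-degrees of the
other vertices.  If Bob really lists [y], this amounts to a pass by Bob in the
game that Alice imagines, so a pass must not hurt her either.  It does not: as
long as Alice wins, some unlisted vertex [z] is light, because the vertex listed
last has all its neighbours before it ([wins_light]); she then imagines that Bob
listed [z] instead of passing, and goes on with [z] as the new imaginary vertex.
The two facts are thus proved together, by induction on the number of unlisted
vertices.

For the theorem, let [k] be the game coloring number of [G - x].  Listing [x]
ahead of everything costs each other vertex at most one more back-neighbour, so
Alice wins on [G] from [[set x]] with the bound [k + 1] ([wins_del_vertex]).
The hypothesis on the degree says that [x] is light for [k + 1], so [x] can be
taken off the list, and Alice wins from [set0]. *)

Set Implicit Arguments.
Unset Strict Implicit.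
Unset Printing Implicit Defensive.

(** * The game on sets of listed vertices *)

Section Positions.
Variables (G : sgraph) (k : nat).
Implicit Types (S : {set G}) (v y : G) (a : bool) (s t tau : seq G).

Definition safe S v : bool := #|[set u in S | adj v u]| < k.

(** The boolean index tells whether Alice is to move.  A full board with Bob to
move is covered by [wins_bob], whose premises are then void. *)
Inductive wins : bool -> {set G} -> Prop :=
| wins_done : wins true setT
| wins_alice S v :
    v \notin S -> safe S v -> wins false (v |: S) -> wins true S
| wins_bob S :
    (forall v, v \notin S -> safe S v) ->
    (forall v, v \notin S -> wins true (v |: S)) -> wins false S.

Lemma safe_sub S S' v : S \subset S' -> safe S' v -> safe S v.
Proof.
move=> sSS'; apply: leq_ltn_trans; apply/subset_leq_card/subsetP => u.
by rewrite !inE => /andP[/(subsetP sSS') -> ->].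
Qed.

Lemma safe_light S v : degree v < k -> safe S v.
Proof.
apply: leq_ltn_trans; apply/subset_leq_card/subsetP => u.
by rewrite !inE => /andP[].
Qed.

Lemma light_safe v : safe (~: [set v]) v -> degree v < k.
Proof.
apply: leq_ltn_trans; apply/subset_leq_card/subsetP => u.
rewrite !inE => vu; rewrite vu andbT.
by apply: contraTneq vu => ->; rewrite adj_irr.
Qed.

Lemma wins_full a : wins a setT.
Proof. by case: a; [apply: wins_done | apply: wins_bob => v; rewrite inE]. Qed.

Lemma wins_bob_inv S v :
  wins false S -> v \notin S -> safe S v /\ wins true (v |: S).
Proof. by move=> w vS; inversion w as [| |? sS wS]; split; auto. Qed.

Lemma wins_step a S : wins a S -> S != setT ->
  exists v, [/\ v \notin S, safe S v & wins (~~ a) (v |: S)].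
Proof.
case=> [|{}S v vS sv w _|{}S sS wS nT]; first by rewrite eqxx.
  by exists v.
have /set0Pn[v] : ~: S != set0.
  by apply: contraNneq nT => S0; rewrite -[S]setCK S0 setC0.
by rewrite inE => vS; exists v; split; [|apply: sS|apply: wS].
Qed.

Lemma card_setC_eq0 S : (#|~: S| == 0) = (S == setT).
Proof. by rewrite cards_eq0 -(inj_eq (@setC_inj G)) setCK setC0. Qed.

Lemma card_setC_setU1 S v n :
  v \notin S -> #|~: S| <= n.+1 -> #|~: (v |: S)| <= n.
Proof.
move=> vS; rewrite (cardsD1 v) inE vS add1n ltnS.
by apply: leq_trans; rewrite setCU setDE setIC.
Qed.

(** In any play that Alice wins, the vertex listed last is light: it is listed
safely when all its neighbours are already there. *)
Lemma wins_light a S :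
  wins a S -> S != setT -> exists2 y, y \notin S & degree y < k.
Proof.
have [n leSn] := ubnPleq #|~: S|.
elim: n a S leSn => [|n IHn] a S leSn w nT.
  by move: leSn; rewrite leqn0 card_setC_eq0 (negbTE nT).
have [v [vS sv wv]] := wins_step w nT.
have [vT|vnT] := eqVneq (v |: S) setT.
  exists v => //; apply: light_safe; apply: safe_sub sv.
  apply/subsetP => u; rewrite !inE => nuv.
  by have := in_setT u; rewrite -vT !inE (negbTE nuv).
have [y yvS ly] := IHn _ _ (card_setC_setU1 vS leSn) wv vnT.
by exists y => //; apply: contra yvS => yS; rewrite inE yS orbT.
Qed.

(** The pass and the imaginary light vertex need each other: Alice answers a
pass by imagining a light vertex, and when Bob lists the imaginary vertex, this
is a pass in a position with fewer unlisted vertices. *)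
Lemma wins_pass_unlist n S : #|~: S| <= n ->
  (wins false S -> wins true S) /\
  (forall a y, degree y < k -> wins a (y |: S) -> wins a S).
Proof.
elim: n S => [|n IHn] S leSn.
  have -> : S = setT by apply/eqP; rewrite -card_setC_eq0 -leqn0.
  by split=> *; apply: wins_full.
have unlist a y : degree y < k -> wins a (y |: S) -> wins a S.
  move=> ly; have [yS|yS] := boolP (y \in S).
    by have /setUidPr-> : [set y] \subset S by rewrite sub1set.
  have sub : S \subset y |: S := subsetUr _ _.
  case: a => w.
    have [yT|ynT] := eqVneq (y |: S) setT.
      (* Only [y] is left, and Alice really lists it. *)
      by apply: (wins_alice yS (safe_light _ ly)); rewrite yT; apply: wins_full.
    have [v [vyS sv wv]] := wins_step w ynT.
    have vS : v \notin S by apply: contra vyS; apply: (subsetP sub).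
    apply: (wins_alice vS (safe_sub sub sv)).
    have [_ IH] := IHn _ (card_setC_setU1 vS leSn).
    by apply: (IH _ _ ly); rewrite setUCA.
  apply: wins_bob => v vS; have [evy|nvy] := eqVneq v y.
  - by rewrite evy; apply: safe_light.
  - have [|sv _] := wins_bob_inv (v := v) w; first by rewrite !inE negb_or nvy.
    exact: safe_sub sub sv.
  - (* Bob really lists [y], and passes in the game that Alice imagines. *)
    have [pass _] := IHn _ (card_setC_setU1 vS leSn).
    by apply: pass; rewrite evy.
  have [|_ wv] := wins_bob_inv (v := v) w; first by rewrite !inE negb_or nvy.
  have [_ IH] := IHn _ (card_setC_setU1 vS leSn).
  by apply: (IH _ _ ly); rewrite setUCA.
split=> // w; have [->|nT] := eqVneq S setT; first exact: wins_full.
have [y yS ly] := wins_light w nT.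
by apply: (unlist _ _ ly); have [] := wins_bob_inv w yS.
Qed.

Lemma wins_unlist a S y : degree y < k -> wins a (y |: S) -> wins a S.
Proof. by have [_] := wins_pass_unlist (leqnn #|~: S|); apply. Qed.

(** * Plays and strategies *)

Lemma col_leP tau : linear_ordering tau ->
  (forall s v t, tau = s ++ v :: t -> safe [set u in s] v) <-> col tau <= k.
Proof.
move=> lin; have utau : uniq tau by rewrite (perm_uniq lin) enum_uniq.
have mtau v : v \in tau by rewrite (perm_mem lin) mem_enum.
have NE s v t : tau = s ++ v :: t ->
    #|Nplus_closed tau v| = #|[set u in [set u in s] | adj v u]|.+1.
  move=> def; move: utau; rewrite def cat_uniq /= negb_or.
  case/and3P=> us /andP[vs _] _.
  rewrite /Nplus_closed cardsU1 !inE adj_irr /= add1n; congr _.+1.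
  apply: eq_card => u; rewrite !inE andbC; congr (_ && _).
  rewrite /before !index_cat (negbTE vs) /= eqxx addn0.
  by case: ifP => us'; [rewrite index_mem | rewrite ltnNge leq_addr].
split=> [safeP|].
  apply/bigmax_leqP => v _.
  have [s [t def]] : exists s t, tau = s ++ v :: t.
    by have /path.splitPr[s t] := mtau v; exists s, t.
  by rewrite (NE s v t def); apply: safeP def.
by move/bigmax_leqP => le s v t def; rewrite /safe -(NE s v t def) le.
Qed.

Lemma follows_rcons (sigma : seq G -> option G) s v :
  follows sigma (rcons s v) <->
  follows sigma s /\ (~~ odd (size s) -> sigma s = Some v).
Proof.
split=> [fol|[fol last_ok] s' v' t].
  split=> [s' v' t def|]; last by apply: (fol s v [::]); rewrite cats1.
  by apply: (fol s' v' (rcons t v)); rewrite def rcons_cat.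
elim/last_ind: t => [|t w _].
  by rewrite cats1 => /rcons_inj[<- <-]; apply: last_ok.
by rewrite -rcons_cons -rcons_cat => /rcons_inj[def _]; apply: fol def.
Qed.

Lemma unlisted_seq s : uniq s -> size s < #|G| -> exists v, v \notin s.
Proof.
move=> us lts; have /set0Pn[v] : ~: [set u in s] != set0.
  by rewrite -card_gt0 cardsCs setCK cardsE (card_uniqP us) subn_gt0.
by rewrite !inE; exists v.
Qed.

Lemma full_seq s : uniq s -> #|G| <= size s -> linear_ordering s.
Proof.
move=> us ges; apply: uniq_perm; rewrite ?enum_uniq //.
have sub : {subset s <= enum G} by move=> v _; rewrite mem_enum.
by case: (uniq_min_size us sub); rewrite -?cardE.
Qed.

(** A play never gets stuck, hence a bound on the complete plays is also a bound
on every move of a partial play. *)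
Lemma extend_play (sigma : seq G -> option G) s :
  alice_strategy sigma -> uniq s -> follows sigma s ->
  exists t, linear_ordering (s ++ t) /\ follows sigma (s ++ t).
Proof.
move=> strat; have [n] := ubnP (#|G| - size s).
elim: n s => // n IHn s len us fol.
have [ges|lts] := leqP #|G| (size s).
  by exists [::]; rewrite cats0; split=> //; apply: full_seq.
have [v vs sv] : exists2 v, v \notin s & ~~ odd (size s) -> sigma s = Some v.
  have [o|e] := boolP (odd (size s)); last first.
    by have [v] := strat s us e lts; exists v.
  by have [v vs] := unlisted_seq us lts; exists v.
have [|||t] := IHn (rcons s v).
- by rewrite size_rcons; lia.
- by rewrite rcons_uniq vs.
- exact/follows_rcons.
by rewrite cat_rcons => ?; exists (v :: t).
Qed.

Lemma set_rcons s v : [set u in rcons s v] = v |: [set u in s].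
Proof. by apply/setP => u; rewrite !inE mem_rcons inE. Qed.

Lemma wins_follows sigma s : alice_strategy sigma -> guarantees sigma k ->
  uniq s -> follows sigma s -> wins (~~ odd (size s)) [set u in s].
Proof.
move=> strat guar; have [n] := ubnP (#|G| - size s).
elim: n s => // n IHn s len us fol.
have [ges|lts] := leqP #|G| (size s).
  have -> : [set u in s] = setT; last exact: wins_full.
  by apply/setP => u; rewrite !inE (perm_mem (full_seq us ges)) mem_enum.
have move_ok v : v \notin s -> (~~ odd (size s) -> sigma s = Some v) ->
    safe [set u in s] v /\ wins (odd (size s)) (v |: [set u in s]).
  move=> vs sv; have usv : uniq (rcons s v) by rewrite rcons_uniq vs.
  have folv : follows sigma (rcons s v) by apply/follows_rcons.
  split.
    have [t [lin folt]] := extend_play strat usv folv.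
    by have /(col_leP lin) := guar _ lin folt; apply; rewrite cat_rcons.
  rewrite -set_rcons -[odd _]negbK -[~~ odd _]/(odd (size s).+1) -(size_rcons s v).
  by apply: IHn => //; rewrite size_rcons; lia.
have [o|e] /= := boolP (odd (size s)).
  rewrite o in move_ok.
  by apply: wins_bob => v; rewrite inE => vs; have [] := move_ok v vs.
have [v sv vs] := strat s us e lts.
have [] := move_ok v vs (fun=> sv); rewrite (negbTE e).
by apply: wins_alice; rewrite inE.
Qed.

Lemma alice_can_guarantee_wins : alice_can_guarantee G k -> wins true set0.
Proof.
case=> sigma strat guar.
have -> : set0 = [set u in [::]] :> {set G} by apply/setP => u; rewrite !inE.
apply: (wins_follows (s := [::]) strat guar) => //.
by case.
Qed.

(** Alice lists any vertex that leads to a won position.  When there is none the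
position is lost, and the strategy lists any unlisted vertex, since a strategy
has to answer every position. *)
Definition winning_move s : option G :=
  if [pick v | [&& v \notin s, safe [set u in s] v
                 & `[< wins false (v |: [set u in s]) >]]] is Some v
  then Some v else [pick v | v \notin s].

Lemma winning_move_wins s v :
  wins true [set u in s] -> winning_move s = Some v -> v \notin s ->
  safe [set u in s] v /\ wins false (v |: [set u in s]).
Proof.
move=> w + vs; rewrite /winning_move; case: pickP => [v' + [<-]|no].
  by case/and3P=> _ sv /asboolP.
have [|nT] := eqVneq [set u in s] setT.
  by move/setP/(_ v); rewrite !inE (negbTE vs).
have [v' [v's sv' w']] := wins_step w nT.
by have := no v'; rewrite inE in v's; rewrite v's sv' asboolT.
Qed.

Lemma wins_alice_can_guarantee : wins true set0 -> alice_can_guarantee G k.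
Proof.
move=> w0; exists winning_move => [s us _ lts|tau lin fol].
  rewrite /winning_move; case: pickP => [v /and3P[vs _ _]|_]; first by exists v.
  case: pickP => [v vs|no]; first by exists v.
  by have [v] := unlisted_seq us lts; rewrite no.
have utau : uniq tau by rewrite (perm_uniq lin) enum_uniq.
have step s v t : tau = s ++ v :: t -> wins (~~ odd (size s)) [set u in s] ->
    safe [set u in s] v /\ wins (odd (size s)) (v |: [set u in s]).
  move=> def w.
  have vs : v \notin s.
    by move: utau; rewrite def cat_uniq /= negb_or => /and3P[_ /andP[]].
  have [o|e] := boolP (odd (size s)).
    by rewrite o in w; apply: wins_bob_inv w _; rewrite inE.
  rewrite e in w; exact: winning_move_wins w (fol _ _ _ def e) vs.
have wins_prefix s t : tau = s ++ t -> wins (~~ odd (size s)) [set u in s].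
  elim/last_ind: s t => [|s v IHs] t.
    by rewrite (_ : [set u in [::]] = set0) //; apply/setP => u; rewrite !inE.
  rewrite cat_rcons => def; rewrite set_rcons size_rcons /= negbK.
  by have [] := step _ _ _ def (IHs _ def).
apply/(col_leP lin) => s v t def.
by have [] := step _ _ _ def (wins_prefix _ _ def).
Qed.

End Positions.

Lemma wins_gcol (G : sgraph) : wins (gcol G) true (set0 : {set G}).
Proof.
apply: alice_can_guarantee_wins; rewrite /gcol.
by case: ex_minnP => k /asboolP.
Qed.

Lemma gcol_le_wins (G : sgraph) k : wins k true (set0 : {set G}) -> gcol G <= k.
Proof.
move=> w; rewrite /gcol; case: ex_minnP => m _; apply.
exact/asboolP/wins_alice_can_guarantee.
Qed.

(** * Deleting a vertex *)

(** Alice copies her moves on [G - x]; the listed [x] adds at most one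
back-neighbour to each vertex. *)
Lemma wins_del_vertex (G : sgraph) (x : G) k a (S : {set del_vertex x}) :
  wins k a S -> wins k.+1 a (x |: [set val u | u in S]).
Proof.
have liftU (v : del_vertex x) (T : {set del_vertex x}) :
    x |: [set val u | u in v |: T] = val v |: (x |: [set val u | u in T]).
  by rewrite imsetU1 setUCA.
have liftN (v : del_vertex x) (T : {set del_vertex x}) :
    v \notin T -> val v \notin x |: [set val u | u in T].
  by move=> vT; rewrite !inE negb_or (valP v) (mem_imset _ _ val_inj).
have liftsafe (v : del_vertex x) (T : {set del_vertex x}) :
    safe k T v -> safe k.+1 (x |: [set val u | u in T]) (val v).
  rewrite /safe ltnS => lt; apply: leq_trans lt.
  rewrite -(card_imset _ val_inj) (cardsD1 x) -add1n leq_add ?leq_b1 //.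
  apply/subset_leq_card/subsetP => z; rewrite !inE => /and3P[zx].
  rewrite (negbTE zx) /= => /imsetP[u uT ->] vu.
  by rewrite (mem_imset _ _ val_inj) inE uT.
elim=> {a S} [|S v vS sv _ IH|S sS _ IH].
- have -> : x |: [set val u | u in [set: del_vertex x]] = setT.
    apply/setP => z; rewrite !inE; have [//|zx] := eqVneq z x.
    by apply/imsetP; exists (Sub z zx : del_vertex x); rewrite ?inE ?SubK.
  exact: wins_done.
- by apply: (wins_alice (liftN _ _ vS) (liftsafe _ _ sv)); rewrite -liftU.
have unlift z : z \notin x |: [set val u | u in S] ->
    exists2 v : del_vertex x, v \notin S & z = val v.
  rewrite !inE negb_or => /andP[zx zS].
  exists (Sub z zx : del_vertex x); last by rewrite SubK.
  apply: contra zS => vS; apply/imsetP.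
  by exists (Sub z zx : del_vertex x); rewrite ?SubK.
apply: wins_bob => z /unlift[v vS ->]; first exact: liftsafe (sS _ vS).
by rewrite -liftU; apply: IH.
Qed.

Theorem proposition7 (G : sgraph) (x : G) (hdeg : degree x <= gcol (del_vertex x)) :
  gcol G <= gcol (del_vertex x) + 1.
Proof.
rewrite addn1; apply: gcol_le_wins; apply: (wins_unlist (y := x)) => //.
by have := wins_del_vertex (wins_gcol (del_vertex x)); rewrite imset0.
Qed.
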